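(* Let $\sigma_0>0$, $\sigma_1>0$, let $g:\mathbb{R}\to\mathbb{R}$ be continuous with $g(\vartheta)>0$ for all $\vartheta$, let $f:\mathbb{R}\to\mathbb{R}$ be continuous with $f(0)=0$, and let $x_0\in\mathbb{R}$. Let $u_{\min,1}\le u_{\min,2}<u_{\max,1}\le u_{\max,2}$ be reals with $u_{\min,1}\neq u_{\min,2}$ or $u_{\max,1}\neq u_{\max,2}$, let $0<t_1<t_2<t_3<t_4$, and let $u:\mathbb{R}^+\to\mathbb{R}$ be a bimodal input as defined in the context (with period $T=t_4$). Consider the LuGre model with input $u$, its hysteresis loop $G_u^\circ$ and its minor loop $\mathcal{N}_u$ as defined in the context. Put $a=\sigma_0/g(0)$ and $$\varrho_0=0,\quad \varrho_1=u_{\max,1}-u_{\min,1},\quad \varrho_2=\varrho_1+u_{\max,1}-u_{\min,2},\quad \varrho_3=\varrho_2+u_{\max,2}-u_{\min,2},\quad \varrho_4=\varrho_3+u_{\max,2}-u_{\min,1},$$ so that $0<\varrho_1<\varrho_2<\varrho_3<\varrho_4$. Define $\psi_u:[0,\varrho_4]\to\mathbb{R}$ by $$\psi_u(t)=\begin{cases} t+u_{\min,1}, & t\in[0,\varrho_1],\\ -t+\varrho_1+u_{\max,1}, & t\in[\varrho_1,\varrho_2],\\ t-\varrho_2+u_{\min,2}, & t\in[\varrho_2,\varrho_3],\\ -t+\varrho_3+u_{\max,2}, & t\in[\varrho_3,\varrho_4].\end{cases}$$ Define $y^\circ:[0,\varrho_4]\to\mathbb{R}$ by $$y^\circ(0)=g(0)\,\frac{\mathrm{e}^{-a\varrho_4}}{1-\mathrm{e}^{-a\varrho_4}}\Big(2\mathrm{e}^{a\varrho_1}-2\mathrm{e}^{a\varrho_2}+2\mathrm{e}^{a\varrho_3}-\mathrm{e}^{a\varrho_4}-1\Big),$$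 $$y^\circ(\varrho_i)=\mathrm{e}^{-a(\varrho_i-\varrho_{i-1})}\Big(y^\circ(\varrho_{i-1})+(-1)^{i-1}g(0)\big[\mathrm{e}^{a(\varrho_i-\varrho_{i-1})}-1\big]\Big),\quad i\in\{1,2,3,4\},$$ and, for $i\in\{0,1,2,3\}$ and $t\in[\varrho_i,\varrho_{i+1}]$, $$y^\circ(t)=\mathrm{e}^{-a(t-\varrho_i)}\Big(y^\circ(\varrho_i)+(-1)^{i}g(0)\big[\mathrm{e}^{a(t-\varrho_i)}-1\big]\Big).$$ Then: (a) the hysteresis loop is $G_u^\circ=\{(\psi_u(t),y^\circ(t)) : t\in[0,\varrho_4]\}$; (b) the minor loop is $\mathcal{N}_u=\{(\psi_u(t),y^\circ(t)) : t\in[\varrho_1,\varrho_5]\}$, where $\varrho_5=u_{\max,1}-u_{\min,2}+\varrho_2\in(\varrho_2,\varrho_3]$.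
   Context: Bimodal input: $u:\mathbb{R}^+\to\mathbb{R}$ is absolutely continuous with $u$ and $\dot u$ essentially bounded (i.e. $u\in W^{1,\infty}(\mathbb{R}^+,\mathbb{R})$), $t_4$-periodic, strictly increasing on $[0,t_1]$, strictly decreasing on $[t_1,t_2]$, strictly increasing on $[t_2,t_3]$, strictly decreasing on $[t_3,t_4]$, with $u(0)=u_{\min,1}$, $u(t_1)=u_{\max,1}$, $u(t_2)=u_{\min,2}$, $u(t_3)=u_{\max,2}$, $u(t_4)=u(0)$. LuGre model: state $x$ and output $F$ given by $\dot x(t)=-\sigma_0\frac{|\dot u(t)|}{g(\dot u(t))}x(t)+\dot u(t)$, $x(0)=x_0$, $F(t)=\sigma_0x(t)+\sigma_1\dot x(t)+f(\dot u(t))$ (Carathéodory solutions). For $\gamma>0$, applying the slowed input $t\mapsto u(t/\gamma)$ and rescaling time back gives the system $\dot z_\gamma(t)=-\sigma_0\frac{|\dot u(t)|}{g(\dot u(t)/\gamma)}z_\gamma(t)+\dot u(t)$, $z_\gamma(0)=x_0$, with output $y_\gamma(t)=\sigma_0 z_\gamma(t)+\frac{\sigma_1}{\gamma}\dot z_\gamma(t)+f(\dot u(t)/\gamma)$. It is known (from prior work) that $y_\gamma$ converges in $L^\infty(\mathbb{R}^+,\mathbb{R})$ as $\gamma\to\infty$ to a function $y^\star_u$, and that, with $T=t_4$, the functions $y^\star_{u,k}(t)=y^\star_u(t+kT)$, $t\in[0,T]$, converge in $L^\infty([0,T],\mathbb{R})$ as $k\to\infty$ to a function $y^\circ_u$.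 The hysteresis loop corresponding to $u$ is $G_u^\circ=\{(u(t),y^\circ_u(t)) : t\in[0,T]\}$. The minor loop corresponding to $u$ is the portion $\mathcal{N}_u=\{(u(t),y^\circ_u(t)) : t\in[t_1,t_5]\}$, where $t_5\in(t_2,t_3]$ is the time with $u(t_5)=u(t_1)$.
   Formalization: Since an L^∞ limit is only defined almost everywhere, y°_u is taken to be its continuous representative on [0,T]; the immediate remarks 0<ϱ1<ϱ2<ϱ3<ϱ4 and ϱ5∈(ϱ2,ϱ3] are not stated separately. *)

(* Defs.v *)
From mathcomp Require Import all_boot all_order all_algebra.
From mathcomp Require Import all_classical all_reals all_analysis.
Set Implicit Arguments. Unset Strict Implicit. Unset Printing Implicit Defensive.
Import Order.TTheory GRing.Theory Num.Theory.
Import numFieldNormedType.Exports.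
Local Open Scope classical_set_scope.
Local Open Scope ring_scope.

Section LuGre.
Variable R : realType.
Local Notation mu := (@lebesgue_measure R).

(* u in W^{1,oo}(R^+,R) with a.e.-derivative du:
   du is measurable and essentially bounded on [0,oo), u is bounded on [0,oo),
   and u(t) = u(0) + int_0^t du (i.e. u is absolutely continuous with u' = du a.e.). *)
Definition W1inf_with_deriv (u du : R -> R) : Prop :=
  [/\ measurable_fun (`[0, +oo[ : set R) du,
      (exists M : R, {ae mu, forall t, 0 <= t -> `|du t| <= M}),
      (exists M : R, forall t, 0 <= t -> `|u t| <= M) &
      (forall t, 0 <= t ->
        mu.-integrable `[0, t] (fun s => (du s)%:E) /\
        u t = u 0 + \int[mu]_(s in `[0, t]) du s)].

Definition strict_incr_on (u : R -> R) (a b : R) : Prop :=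
  forall x y, a <= x -> x < y -> y <= b -> u x < u y.
Definition strict_decr_on (u : R -> R) (a b : R) : Prop :=
  forall x y, a <= x -> x < y -> y <= b -> u y < u x.

Definition bimodal_input (u : R -> R) (t1 t2 t3 t4 umin1 umax1 umin2 umax2 : R)
  : Prop :=
  [/\ (forall t, 0 <= t -> u (t + t4) = u t),
      [/\ strict_incr_on u 0 t1, strict_decr_on u t1 t2,
      strict_incr_on u t2 t3 & strict_decr_on u t3 t4] &
      [/\ u 0 = umin1, u t1 = umax1, u t2 = umin2, u t3 = umax2 & u t4 = u 0]].

Definition lugre_rhs (sigma0 : R) (g : R -> R) (du : R -> R) (gamma : R)
  (z : R -> R) (s : R) : R :=
  - sigma0 * `|du s| / g (du s / gamma) * z s + du s.

Definition caratheodory_sol (sigma0 : R) (g du : R -> R) (gamma x0 : R)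
  (z : R -> R) : Prop :=
  forall t, 0 <= t ->
    mu.-integrable `[0, t] (fun s => (lugre_rhs sigma0 g du gamma z s)%:E) /\
    z t = x0 + \int[mu]_(s in `[0, t]) lugre_rhs sigma0 g du gamma z s.

(* Output y_gamma = sigma0 z + (sigma1/gamma) z' + f(u'/gamma), where z' is
   (a.e.) the right-hand side of the state equation. *)
Definition lugre_output (sigma0 sigma1 : R) (g f du : R -> R) (gamma : R)
  (z : R -> R) (t : R) : R :=
  sigma0 * z t + sigma1 / gamma * lugre_rhs sigma0 g du gamma z t
  + f (du t / gamma).

Definition Linf_cvg_gamma (y : R -> R -> R) (ystar : R -> R) : Prop :=
  forall eps : R, 0 < eps -> exists G : R, forall gamma : R, G <= gamma -> 0 < gamma ->
    {ae mu, forall t, 0 <= t -> `|y gamma t - ystar t| <= eps}.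

Definition Linf_cvg_periods (ystar : R -> R) (T : R) (yo : R -> R) : Prop :=
  forall eps : R, 0 < eps -> exists K : nat, forall k : nat, (K <= k)%N ->
    {ae mu, forall t, 0 <= t <= T -> `|ystar (t + k%:R * T) - yo t| <= eps}.

Definition rho1 (umin1 umax1 umin2 umax2 : R) := umax1 - umin1.
Definition rho2 (umin1 umax1 umin2 umax2 : R) :=
  rho1 umin1 umax1 umin2 umax2 + umax1 - umin2.
Definition rho3 (umin1 umax1 umin2 umax2 : R) :=
  rho2 umin1 umax1 umin2 umax2 + umax2 - umin2.
Definition rho4 (umin1 umax1 umin2 umax2 : R) :=
  rho3 umin1 umax1 umin2 umax2 + umax2 - umin1.
Definition rho5 (umin1 umax1 umin2 umax2 : R) :=
  umax1 - umin2 + rho2 umin1 umax1 umin2 umax2.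

Definition psi_u (umin1 umax1 umin2 umax2 : R) (t : R) : R :=
  let r1 := rho1 umin1 umax1 umin2 umax2 in
  let r2 := rho2 umin1 umax1 umin2 umax2 in
  let r3 := rho3 umin1 umax1 umin2 umax2 in
  if t <= r1 then t + umin1
  else if t <= r2 then - t + r1 + umax1
  else if t <= r3 then t - r2 + umin2
  else - t + r3 + umax2.

Definition ypiece (a g0 : R) (i : nat) (rhoi Y t : R) : R :=
  expR (- a * (t - rhoi)) * (Y + (-1) ^+ i * g0 * (expR (a * (t - rhoi)) - 1)).

Definition ycirc (sigma0 : R) (g : R -> R) (umin1 umax1 umin2 umax2 : R)
  (t : R) : R :=
  let g0 := g 0 in
  let a := sigma0 / g0 in
  let r1 := rho1 umin1 umax1 umin2 umax2 in
  let r2 := rho2 umin1 umax1 umin2 umax2 in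
  let r3 := rho3 umin1 umax1 umin2 umax2 in
  let r4 := rho4 umin1 umax1 umin2 umax2 in
  let Y0 := g0 * (expR (- a * r4) / (1 - expR (- a * r4))) *
            (2 * expR (a * r1) - 2 * expR (a * r2) + 2 * expR (a * r3)
             - expR (a * r4) - 1) in
  let Y1 := ypiece a g0 0 0 Y0 r1 in
  let Y2 := ypiece a g0 1 r1 Y1 r2 in
  let Y3 := ypiece a g0 2 r2 Y2 r3 in
  if t <= r1 then ypiece a g0 0 0 Y0 t
  else if t <= r2 then ypiece a g0 1 r1 Y1 t
  else if t <= r3 then ypiece a g0 2 r2 Y2 t
  else ypiece a g0 3 r3 Y3 t.

End LuGre.

(* Main.v *)
Require Import Defs.
From mathcomp Require Import all_boot all_order all_algebra.
From mathcomp Require Import all_classical all_reals all_analysis.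
From mathcomp Require Import measurable_realfun zify ring lra.
Set Implicit Arguments. Unset Strict Implicit. Unset Printing Implicit Defensive.
Import Order.TTheory GRing.Theory Num.Theory.
Import numFieldNormedType.Exports.
Local Open Scope classical_set_scope.
Local Open Scope ring_scope.

(** For an absolutely continuous [u] of sign-definite slope [e = +-1], the limit
    system [z' = - (s0 / g 0) |u'| z + u'] is solved explicitly by a function of
    [u] alone, [(e g(0) + C exp (- a e u)) / s0]; the constants [C] of the four
    monotone pieces are fixed by continuity and periodicity.  The difference
    between [z_gamma] and this periodic solution drifts towards a ball whose
    radius vanishes as [gamma] grows: outside of the ball it loses on each
    monotone piece an amount bounded below uniformly in [gamma].  Hence after
    finitely many periods, uniformly in [gamma], the output is close to the
    explicit solution, and [yo] equals it almost everywhere, then everywhere by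
    continuity.  Reparametrizing by the variation of [u] gives the loops. *)

Section LuGreLoop.
Variable R : realType.
Local Notation mu := (@lebesgue_measure R).
Implicit Types (F f v r b : R -> R) (p q s t M B : R).

(** * Calculus of primitives of integrable functions *)

Local Instance ae_lebesgue_filter : Filter (nbhs (almost_everywhere mu)).
Proof. exact: ae_filter_ringOfSetsType. Qed.

(** Absolute continuity is phrased through increments, so that it passes to subintervals and linear
    combinations without a base point to carry along. *)
Definition primitive F f p q :=
  mu.-integrable `[p, q] (EFin \o f) /\
  forall s t, p <= s -> s <= t -> t <= q -> F t - F s = \int[mu]_(x in `[s, t]) f x.

Lemma integrable_subitv f p q s t : p <= s -> t <= q ->
  mu.-integrable `[p, q] (EFin \o f) -> mu.-integrable `[s, t] (EFin \o f).
Proof.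
move=> ps tq; apply: integrableS => //.
by apply: subset_itvScc; rewrite ?bnd_simp.
Qed.

Lemma Rintegral_itv_split f p q s : p <= s -> s <= q ->
  mu.-integrable `[p, q] (EFin \o f) ->
  \int[mu]_(x in `[p, q]) f x - \int[mu]_(x in `[p, s]) f x =
  \int[mu]_(x in `[s, q]) f x.
Proof.
move=> ps sq fi; rewrite Rintegral_itvB ?bnd_simp// Rintegral_itv_obnd_cbnd//.
by apply: integrableS fi => //; apply: subset_itvr; rewrite bnd_simp.
Qed.

Lemma primitive_sub F f p q s t : p <= s -> t <= q ->
  primitive F f p q -> primitive F f s t.
Proof.
move=> ps tq [fi Ff]; split; first exact: integrable_subitv fi.
move=> x y sx xy yt; apply: Ff => //; lra.
Qed.

Lemma primitive_from0 F f c p q : 0 <= p ->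
  (forall t, 0 <= t -> mu.-integrable `[0, t] (EFin \o f) /\
     F t = c + \int[mu]_(s in `[0, t]) f s) ->
  p <= q -> primitive F f p q.
Proof.
move=> p0 H pq; split.
  by apply: integrable_subitv (H q _).1 => //; lra.
move=> s t ps st tq; rewrite (H t _).2 ?(H s _).2; [|lra|lra].
rewrite -(@Rintegral_itv_split f 0 t s); [lra|lra|lra|apply: (H t _).1; lra].
Qed.

Lemma primitiveB F f G g p q : primitive F f p q -> primitive G g p q ->
  primitive (fun x => F x - G x) (fun x => f x - g x) p q.
Proof.
move=> [fi Ff] [gi Gg]; split.
  by apply: (@integrableB _ _ _ mu `[p, q] _ (EFin \o f) (EFin \o g)).
move=> s t ps st tq; rewrite RintegralB//.
- by rewrite -Ff// -Gg//; ring.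
- exact: integrable_subitv fi.
- exact: integrable_subitv gi.
Qed.

Lemma primitiveZ k F f p q : primitive F f p q ->
  primitive (fun x => k * F x) (fun x => k * f x) p q.
Proof.
move=> [fi Ff]; split.
  by apply: (@integrableZl _ _ _ mu `[p, q] _ k (EFin \o f)).
move=> s t ps st tq; rewrite RintegralZl//.
- by rewrite -Ff// mulrBr.
- exact: integrable_subitv fi.
Qed.

Lemma Rintegral_ae_ge0 (D : set R) f : measurable D ->
  mu.-integrable D (EFin \o f) -> {ae mu, forall x, D x -> 0 <= f x} ->
  0 <= \int[mu]_(x in D) f x.
Proof.
move=> mD fi f0.
have mf : measurable_fun D f by apply/measurable_EFinP; exact: measurable_int fi.
have -> : \int[mu]_(x in D) f x = \int[mu]_(x in D) `|f x|.
  congr fine; apply: ae_eq_integral => //.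
  - exact/measurable_EFinP.
  - by apply/measurable_EFinP; exact: measurableT_comp.
  - by apply: filterS f0 => x + Dx => /(_ Dx) /ger0_norm /= ->.
exact: Rintegral_ge0.
Qed.

Lemma ae_le_Rintegral (D : set R) f g : measurable D ->
  mu.-integrable D (EFin \o f) -> mu.-integrable D (EFin \o g) ->
  {ae mu, forall x, D x -> f x <= g x} ->
  \int[mu]_(x in D) f x <= \int[mu]_(x in D) g x.
Proof.
move=> mD fi gi fg; rewrite -subr_ge0 -RintegralB//.
apply: Rintegral_ae_ge0 => //.
  exact: (@integrableB _ _ _ mu D _ (EFin \o g) (EFin \o f)).
by apply: filterS fg => x + Dx => /(_ Dx); rewrite subr_ge0.
Qed.

Lemma integrable_itv_cst p q c : mu.-integrable `[p, q] (EFin \o cst c).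
Proof.
apply: measurable_bounded_integrable => //=.
  rewrite lebesgue_measure_itv/=; case: ifP => // _; exact: ltry.
exists (`|c|); split; first exact: num_real.
by move=> x cx y _ /=; exact: ltW.
Qed.

Lemma Rintegral_itv_cst p q c : p <= q ->
  \int[mu]_(x in `[p, q]) c = c * (q - p).
Proof.
move=> pq; rewrite Rintegral_cst//= lebesgue_measure_itv/= lte_fin.
case: ifPn => [_ //|]; rewrite -leNgt => qp.
have -> : q = p by lra.
by rewrite subrr.
Qed.

Lemma ae_Rintegral_bound f p q M : p <= q ->
  mu.-integrable `[p, q] (EFin \o f) ->
  {ae mu, forall x, p <= x <= q -> `|f x| <= M} ->
  `|\int[mu]_(x in `[p, q]) f x| <= M * (q - p).
Proof.
move=> pq fi fM; rewrite -Rintegral_itv_cst//.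
apply: le_trans (le_normr_Rintegral _ fi) _ => //.
apply: ae_le_Rintegral => //.
- exact: integrable_norm.
- exact: integrable_itv_cst.
Qed.

Lemma primitive_lipschitz F f p q M : primitive F f p q ->
  {ae mu, forall x, p <= x <= q -> `|f x| <= M} ->
  forall s t, p <= s -> s <= t -> t <= q -> `|F t - F s| <= M * (t - s).
Proof.
move=> [fi Ff] fM s t ps st tq; rewrite Ff//; apply: ae_Rintegral_bound => //.
  exact: integrable_subitv fi.
by apply: filterS fM => x + sxt; apply; lra.
Qed.

Lemma within_itvP F p q : {within `[p, q], continuous F} <->
  forall x, p <= x <= q -> forall e, 0 < e -> exists2 d, 0 < d &
    forall y, p <= y <= q -> `|x - y| < d -> `|F x - F y| < e.
Proof.
split=> [/subspace_continuousP H x xpq e e0|H].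
  have /H /cvgrPdist_lt/(_ e e0) : `[p, q]%classic x by rewrite /= in_itv.
  rewrite /within/= => /nbhs_ballP[d /= d0 {}H].
  by exists d => // y ypq xy; apply: H; rewrite //= in_itv.
apply/subspace_continuousP => x; rewrite /= in_itv/= => xpq.
apply/cvgrPdist_lt => e e0; have [d d0 {}H] := H x xpq e e0.
apply/nbhs_ballP; exists d => //= y xy; rewrite in_itv/= => ypq.
exact: H.
Qed.

Lemma primitive_continuous F f p q : primitive F f p q -> p <= q ->
  {within `[p, q], continuous F}.
Proof.
move=> [fi Ff] pq; apply/within_itvP => x xpq e e0.
have /within_itvP/(_ _ xpq e e0)[d d0 H] := parameterized_integral_continuous pq fi.
exists d => // y ypq xy; have := H y ypq xy.
rewrite /= /parameterized_integral -!Ff; [|lra..].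
by congr (`|_| < _); ring.
Qed.

(** * The exponential of an absolutely continuous function *)

Lemma quadratic_increment_const F p q C : p <= q ->
  (forall s t, p <= s -> s <= t -> t <= q -> `|F t - F s| <= C * (t - s) ^+ 2) ->
  F q = F p.
Proof.
move=> pq FC.
have C0 : 0 <= C * (q - p) ^+ 2 by apply: le_trans (FC p q _ _ _).
(* Over [n.+1] equal steps the quadratic bounds add up to [C * (q - p) ^+ 2 / n.+1%:R]. *)
have main n : n.+1%:R * `|F q - F p| <= C * (q - p) ^+ 2.
  pose h := (q - p) / n.+1%:R.
  have n0 : 0 < n.+1%:R :> R by rewrite ltr0n.
  have h0 : 0 <= h by rewrite divr_ge0//; lra.
  have hn : n.+1%:R * h = q - p by rewrite /h; field; rewrite lt0r_neq0.
  have step k : (k <= n.+1)%N -> `|F (p + k%:R * h) - F p| <= k%:R * (C * h ^+ 2).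
    elim: k => [|k IH] kn; first by rewrite !mul0r addr0 subrr normr0.
    have kh : k.+1%:R * h <= q - p by rewrite -hn ler_wpM2r// ler_nat.
    have kh0 : 0 <= k%:R * h by rewrite mulr_ge0.
    have kS : k.+1%:R = k%:R + 1 :> R by rewrite -natr1.
    have := FC (p + k%:R * h) (p + k.+1%:R * h).
    have -> : p + k.+1%:R * h - (p + k%:R * h) = h by rewrite kS; ring.
    move=> /(_ _ _ _) H.
    have {}H : `|F (p + k.+1%:R * h) - F (p + k%:R * h)| <= C * h ^+ 2.
      by apply: H; rewrite ?kS in kh *; lra.
    have -> : F (p + k.+1%:R * h) - F p = (F (p + k.+1%:R * h) - F (p + k%:R * h)) +
       (F (p + k%:R * h) - F p) by ring.
    apply: le_trans (ler_normD _ _) _.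
    have := IH (ltnW kn); rewrite [in k.+1%:R * (C * _)]kS mulrDl mul1r; lra.
  have := step n.+1 (leqnn _); rewrite hn.
  have -> : p + (q - p) = q by ring.
  move=> H; have -> : C * (q - p) ^+ 2 = n.+1%:R * (n.+1%:R * (C * h ^+ 2)).
    by rewrite -hn; ring.
  by rewrite ler_pM2l.
apply/eqP; rewrite -subr_eq0 -normr_le0 leNgt; apply/negP => D0.
set D := `|_| in main D0.
(* This [n] makes [n.+1] exceed [C * (q - p) ^+ 2 / D], against [main]. *)
have := main (Num.truncn (C * (q - p) ^+ 2 / D)).
apply/negP; rewrite -ltNge -ltr_pdivrMr//.
exact: truncnS_gt.
Qed.

Lemma expR_lipschitz (E a b : R) : expR a <= E -> expR b <= E ->
  `|expR b - expR a| <= E * `|b - a|.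
Proof.
wlog ab : a b / a <= b => [H aE bE|aE bE].
  case/orP: (le_total a b) => ?; first exact: H.
  by rewrite distrC [`|b - a|]distrC; exact: H.
have eab : expR a <= expR b by rewrite ler_expR.
rewrite ger0_norm ?subr_ge0// ger0_norm ?subr_ge0//.
have : expR b * (1 + (a - b)) <= expR b * expR (a - b).
  by rewrite ler_wpM2l ?expR_ge0// expR_ge1Dx.
rewrite -expRD subrKC => H.
have : expR b * (b - a) <= E * (b - a) by rewrite ler_wpM2r// subr_ge0.
lra.
Qed.

(** The exponential lies above its tangents: the one at [a] makes the remainder nonnegative, the one
    at [b] bounds it by [(expR b - expR a) * (b - a)]. *)
Lemma expR_taylor1 (E a b : R) : expR a <= E -> expR b <= E ->
  `|expR b - expR a - expR a * (b - a)| <= E * (b - a) ^+ 2.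
Proof.
move=> aE bE.
have H1 : expR b * (1 + (a - b)) <= expR b * expR (a - b).
  by rewrite ler_wpM2l ?expR_ge0// expR_ge1Dx.
have H2 : expR a * (1 + (b - a)) <= expR a * expR (b - a).
  by rewrite ler_wpM2l ?expR_ge0// expR_ge1Dx.
rewrite -!expRD !subrKC in H1 H2.
rewrite ger0_norm; last by lra.
have H3 : expR b - expR a - expR a * (b - a) <= (expR b - expR a) * (b - a) by lra.
apply: le_trans H3 _; apply: le_trans (ler_norm _) _.
rewrite normrM -real_normK ?num_real// expr2 mulrA ler_wpM2r//.
exact: expR_lipschitz.
Qed.

(* The increments of [expR \o V] differ from the integral of the claimed
   derivative by a quadratic error, hence not at all. *)
Lemma primitive_expR V d p q M : p <= q -> 0 <= M -> primitive V d p q ->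
  {ae mu, forall x, p <= x <= q -> `|d x| <= M} ->
  primitive (fun t => expR (V t)) (fun t => expR (V t) * d t) p q.
Proof.
move=> pq M0 Vd dM; have [di VE] := Vd.
have Vlip := primitive_lipschitz Vd dM.
pose E := expR (`|V p| + M * (q - p)).
have VEb x : p <= x <= q -> expR (V x) <= E.
  move=> xpq; rewrite ler_expR.
  have := Vlip p x (lexx _); have := ler_norm (V p).
  have := ler_norm (V x - V p).
  have : M * (x - p) <= M * (q - p) by rewrite ler_wpM2l//; lra.
  lra.
have E0 : 0 <= E := expR_ge0 _.
have mV : measurable_fun `[p, q] (fun t => expR (V t)).
  apply: measurableT_comp => //.
  by apply: subspace_continuous_measurable_fun => //; exact: primitive_continuous Vd pq.
have gi : mu.-integrable `[p, q] (EFin \o (fun t => expR (V t) * d t)).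
  apply: (@integrableMr _ _ _ mu `[p, q] _ (fun t => expR (V t)) (EFin \o d)) => //.
  exists E; split; first exact: num_real.
  move=> x Ex y; rewrite /= in_itv/= => yE.
  by rewrite ger0_norm ?expR_ge0// (le_trans (VEb y yE))// ltW.
split=> // s t ps st tq.
pose I x := \int[mu]_(y in `[p, x]) (expR (V y) * d y).
have IE x y : p <= x -> x <= y -> y <= q ->
    I y - I x = \int[mu]_(z in `[x, y]) (expR (V z) * d z).
  move=> px xy yq; apply: Rintegral_itv_split => //.
  exact: integrable_subitv gi.
rewrite -IE//.
suff : expR (V t) - I t = expR (V s) - I s by lra.
(* One [E * M ^+ 2] pays for the Taylor remainder of the exponential, the other for freezing
   [expR (V z)] at [z = x] under the integral. *)
apply: (quadratic_increment_const (F := fun x => expR (V x) - I x) (C := 2 * E * M ^+ 2)) => //.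
move=> x y sx xy yt.
have px : p <= x by lra.
have yq : y <= q by lra.
have xpq : p <= x <= q by lra.
have ypq : p <= y <= q by lra.
have -> : expR (V y) - I y - (expR (V x) - I x) =
  (expR (V y) - expR (V x) - expR (V x) * (V y - V x)) -
    \int[mu]_(z in `[x, y]) ((expR (V z) - expR (V x)) * d z).
  under eq_Rintegral do rewrite mulrBl.
  rewrite RintegralB//; last 2 first.
  - exact: integrable_subitv gi.
  - apply: (@integrableZl _ _ _ mu `[x, y] _ (expR (V x)) (EFin \o d)) => //.
    exact: integrable_subitv di.
  rewrite RintegralZl//; last exact: integrable_subitv di.
  by rewrite -IE// -VE//; ring.
apply: le_trans (ler_normB _ _) _.
have T1 : `|expR (V y) - expR (V x) - expR (V x) * (V y - V x)| <= E * M ^+ 2 * (y - x) ^+ 2.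
  apply: le_trans (expR_taylor1 (VEb _ xpq) (VEb _ ypq)) _.
  rewrite -mulrA -exprMn ler_wpM2l// -real_normK ?num_real//.
  by rewrite lerXn2r ?nnegrE ?mulr_ge0 ?Vlip//; lra.
have T2 : `|\int[mu]_(z in `[x, y]) ((expR (V z) - expR (V x)) * d z)| <=
    (E * (M * (y - x)) * M) * (y - x).
  apply: ae_Rintegral_bound => //.
    have -> : (fun z => (expR (V z) - expR (V x)) * d z) =
        (fun z => expR (V z) * d z - expR (V x) * d z).
      by apply/funext => z; rewrite mulrBl.
    apply: (@integrableB _ _ _ mu `[x, y] _ (EFin \o (fun z => expR (V z) * d z))
      (EFin \o (fun z => expR (V x) * d z))) => //.
      exact: integrable_subitv gi.
    apply: (@integrableZl _ _ _ mu `[x, y] _ (expR (V x)) (EFin \o d)) => //.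
    exact: integrable_subitv di.
  apply: filterS dM => z dz xzy; rewrite normrM ler_pM//; last by apply: dz; lra.
  apply: le_trans (expR_lipschitz (VEb _ xpq) (VEb z _)) _; first lra.
  rewrite ler_wpM2l//; apply: le_trans (Vlip x z _ _ _) _; [lra..|].
  by rewrite ler_wpM2l//; lra.
lra.
Qed.

(** * Almost everywhere statements *)

Lemma ae_neq (c : R) : {ae mu, forall x, x != c}.
Proof.
rewrite /prop_near1/= /nbhs/= /almost_everywhere/=.
exists [set c]; split => //; first exact: lebesgue_measure_set1.
by move=> x /= /negP; rewrite negbK => /eqP.
Qed.

Lemma ae_itv_dense (P : R -> Prop) s t : s < t -> {ae mu, forall x, P x} ->
  exists2 x, s < x < t & P x.
Proof.
move=> st [N [mN N0 PN]]; apply: contrapT => H.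
have : (mu `]s, t[%classic <= mu N)%E.
  apply: le_measure; rewrite ?inE//.
  move=> x; rewrite /= in_itv/= => sxt; apply: PN => /= Px.
  by apply: H; exists x.
rewrite N0 lebesgue_measure_itv/= lte_fin st -EFinD lee_fin; lra.
Qed.

(** The image of Lebesgue measure under a translation agrees with it on half-open intervals, hence
    everywhere by uniqueness; so preimages of null sets are null. *)
Lemma ae_shift (P : R -> Prop) c : {ae mu, forall x, P x} ->
  {ae mu, forall x, P (x + c)}.
Proof.
move=> [N [mN N0 PN]].
have mc : measurable_fun setT (fun x : measurableTypeR R => x + c : measurableTypeR R).
  exact: measurable_funD.
exists ((fun x => x + c) @^-1` N); split.
- by rewrite -[X in measurable X]setTI; exact: mc.
- rewrite -N0; symmetry.
  apply: (@lebesgue_measure_unique R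
    (pushforward mu (fun x : measurableTypeR R => x + c : measurableTypeR R))) => //.
  move=> _ [[a b] _ <-] /=; rewrite /pushforward.
  have -> : (fun x => x + c) @^-1` `]a, b]%classic = `](a - c), (b - c)]%classic.
    by apply/seteqP; split => x /=; rewrite !in_itv/= => ?; lra.
  rewrite !lebesgue_measure_itv/= !lte_fin ltrD2r; case: ifP => // _.
  by rewrite -!EFinD; congr (_%:E); ring.
- by move=> x /= H; apply: PN.
Qed.

Lemma derive1_ge0_near F x : derivable F x 1 ->
  (\forall h \near 0^', 0 <= h^-1 * (F (h + x) - F x)) -> 0 <= derive1 F x.
Proof.
move=> dF H; rewrite derive1E /derive; apply: limr_ge => //.
near=> h; rewrite /= /GRing.scale/= mulr1; near: h; exact: H.
Unshelve. all: by end_near. Qed.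

(** By Lebesgue differentiation [f] is almost everywhere the derivative of its integral, and a
    nondecreasing function has nonnegative difference quotients. *)
Lemma primitive_nondecr_ae_ge0 F f p q : primitive F f p q ->
  (forall x y, p <= x -> x <= y -> y <= q -> F x <= F y) ->
  {ae mu, forall x, p <= x <= q -> 0 <= f x}.
Proof.
move=> [fi FE] Fmono.
pose g := f \_ `[p, q].
have gi : mu.-integrable setT (EFin \o g).
  by rewrite -restrict_EFin; apply/integrable_restrict => //=; rewrite setTI.
have gl : locally_integrable [set: R] g by exact: integrable_locally fi.
have gi' y : mu.-integrable [set` Interval (BLeft p) (BRight y)] (EFin \o g).
  exact: integrableS gi.
have /= H := FTC1 gi' gl.
(* Away from the endpoints, both points of a small difference quotient stay in [[p, q]], where [G]
   is [F] up to a constant. *)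
apply: filterS3 H (ae_neq p) (ae_neq q) => x H xp xq xpq.
have pxq : p < x < q by lra.
pose G x := \int[mu]_(t in `[p, x]) g t.
have [dG GE] : derivable G x 1 /\ derive1 G x = g x.
  by apply: H; rewrite /= lte_fin; lra.
rewrite -/G in dG GE.
have -> : f x = g x by rewrite /g patchE mem_set//= in_itv/=.
rewrite -GE; apply: derive1_ge0_near => //.
have GF y : p <= y <= q -> G y = F y - F p.
  move=> ypq; rewrite FE; [|lra..].
  apply: eq_Rintegral => z; rewrite inE/= in_itv/= => zpy.
  by rewrite /g patchE mem_set//= in_itv/=; lra.
have d0 : 0 < Num.min (x - p) (q - x) by rewrite lt_min; lra.
near=> h.
have hd : `|h| < Num.min (x - p) (q - x).
  near: h; apply: dnbhs0_lt; exact: d0.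
move: hd; rewrite lt_min !ltr_norml => /andP[hd1 hd2].
rewrite !GF; [|lra..].
have [h0|h0] := leP 0 h.
  rewrite mulr_ge0 ?invr_ge0//; have := Fmono x (h + x); lra.
rewrite -[X in 0 <= X]opprK -mulrN oppr_ge0.
rewrite mulr_le0_ge0 ?invr_le0 ?(ltW h0)//; have := Fmono (h + x) x; lra.
Unshelve. all: by end_near. Qed.

(** * Differential inequalities above a threshold *)

(* [v] cannot cross a level [B >= eta] upwards: after the last time at which
   [v <= B] it would be nonincreasing. *)
Lemma barrier v r p q eta B : p <= q -> primitive v r p q ->
  {ae mu, forall x, p <= x <= q -> eta <= v x -> r x <= 0} ->
  eta <= B -> v p <= B -> forall t, p <= t <= q -> v t <= B.
Proof.
move=> pq vr Hr etaB vpB t tpq; rewrite leNgt; apply/negP => vtB.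
have vc := primitive_continuous vr pq; move/within_itvP in vc.
pose S := [set s | p <= s <= t /\ v s <= B].
have Sp : S p by split => //; lra.
have hS : has_sup S.
  by split; [exists p|exists t => x [xt _]; lra].
have pS : p <= sup S by apply: ub_le_sup Sp; exact: hS.2.
have St : sup S <= t by apply: ge_sup; [exists p|move=> x [xt _]; lra].
(* Points of [S] accumulate at [sup S], so continuity carries the bound over to it. *)
have vS : v (sup S) <= B.
  rewrite leNgt; apply/negP => vSB.
  have [||d d0 H] := vc (sup S) _ (v (sup S) - B); [lra..|].
  have [x [xpt vxB] xS] := sup_adherent d0 hS.
  have xS' : x <= sup S by apply: ub_le_sup; [exact: hS.2|split].
  have := H x; rewrite ltr_norml ltr_norml; lra.
have : \int[mu]_(x in `[sup S, t]) r x <= 0.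
  have [ri _] := vr.
  rewrite -[leRHS](_ : \int[mu]_(x in `[sup S, t]) 0 = 0); last first.
    by rewrite Rintegral_itv_cst// mul0r.
  apply: ae_le_Rintegral => //.
  - by apply: integrable_subitv ri; lra.
  - exact: integrable_itv_cst.
  - apply: filterS2 Hr (ae_neq (sup S)) => x Hr xS; rewrite /= in_itv/= => Sxt.
    apply: Hr; first lra.
    rewrite leNgt; apply/negP => vx.
    have : x <= sup S by apply: ub_le_sup; [exact: hS.2|split; lra].
    lra.
rewrite -vr.2//; lra.
Qed.

(** If [v] ever reaches [eta], then [barrier] with level [eta] traps it below; otherwise the drift
    acts on all of [[p, q]] and the whole integral of [b] is lost. *)
Lemma barrier_decay v r b p q eta B : p <= q -> primitive v r p q ->
  mu.-integrable `[p, q] (EFin \o b) ->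
  {ae mu, forall x, p <= x <= q -> 0 <= b x} ->
  {ae mu, forall x, p <= x <= q -> eta <= v x -> r x <= - b x} ->
  v p <= B -> v q <= Num.max eta (B - \int[mu]_(x in `[p, q]) b x).
Proof.
move=> pq vr bi b0 Hr vB; rewrite le_max.
have [[t tpq vt]|H] := pselect (exists2 t, p <= t <= q & v t <= eta).
  apply/orP; left.
  apply: (@barrier v r t q eta eta) => //; [lra| | |lra].
    by apply: primitive_sub vr; lra.
  apply: filterS2 b0 Hr => x b0 Hr xtq vx.
  have := b0; have := Hr; lra.
apply/orP; right.
have [ri vE] := vr.
have nbi : mu.-integrable `[p, q] (EFin \o (fun x => -1 * b x)).
  exact: (@integrableZl _ _ _ mu `[p, q] _ (-1) (EFin \o b)).
have : \int[mu]_(x in `[p, q]) r x <= \int[mu]_(x in `[p, q]) (-1 * b x).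
  apply: ae_le_Rintegral => //.
  apply: filterS Hr => x Hr; rewrite /= in_itv/= => xpq.
  rewrite mulN1r; apply: Hr => //; rewrite leNgt; apply/negP => vx.
  by apply: H; exists x => //; lra.
rewrite RintegralZl// -vE//; lra.
Qed.

(* Here [D = |u'|]; the radius [e1 * W / g0] comes from replacing [g (u' / gamma)] by [g 0]. *)
Lemma error_drift (s0 g0 G e1 D z w W delta : R) :
  0 < s0 -> 0 < g0 -> 0 < G -> `|G - g0| <= e1 -> e1 <= g0 -> 0 <= D ->
  `|w| <= W -> 0 <= delta -> e1 * W / g0 + delta <= z - w ->
  - s0 * D / G * z + s0 / g0 * D * w <= - (delta * s0 / (2 * g0) * D).
Proof.
move=> s00 g00 G0 Gg e1g D0 wW d0 H.
have ng0 : g0 != 0 by rewrite gt_eqF.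
have nG : G != 0 by rewrite gt_eqF.
pose k := s0 * D / G.
have k0 : 0 <= k by rewrite divr_ge0 ?mulr_ge0// ltW.
(* The first term damps the error [z - w]; the second is the cost of [G] differing from [g0]. *)
have -> : - s0 * D / G * z + s0 / g0 * D * w =
    - (k * (z - w)) + k * ((G - g0) * w / g0).
  by rewrite /k; field; rewrite ng0 nG.
have H1 : (G - g0) * w / g0 <= e1 * W / g0.
  rewrite ler_pM2r ?invr_gt0//; apply: le_trans (ler_norm _) _.
  by rewrite normrM ler_pM.
(* From [e1 <= g0] one gets [G <= 2 * g0], whence the factor 2 in the rate. *)
have H2 : s0 * D / (2 * g0) <= k.
  rewrite /k ler_wpM2l ?mulr_ge0 ?(ltW s00)// lef_pV2 ?posrE//; last by lra.
  by move: Gg; rewrite ler_norml; lra.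
have : k * ((G - g0) * w / g0) <= k * (e1 * W / g0) by rewrite ler_wpM2l.
have : k * (e1 * W / g0 + delta) <= k * (z - w) by rewrite ler_wpM2l.
have : delta * (s0 * D / (2 * g0)) <= delta * k by rewrite ler_wpM2l.
have -> : delta * s0 / (2 * g0) * D = delta * (s0 * D / (2 * g0)) by ring.
rewrite mulrDr; lra.
Qed.

(** * The explicit solution and the error on a monotone piece *)

Definition hyst_arc (a g0 e C x : R) : R := e * g0 + C * expR (- (a * e) * x).

Lemma primitive_arc (u du : R -> R) (s0 g0 e C p q M : R) :
  p <= q -> 0 <= M -> 0 < s0 -> 0 < g0 ->
  primitive u du p q -> {ae mu, forall x, p <= x <= q -> `|du x| <= M} ->
  primitive (fun t => hyst_arc (s0 / g0) g0 e C (u t) / s0)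
    (fun t => - (e * C / g0) * (expR (- (s0 / g0 * e) * u t) * du t)) p q.
Proof.
move=> pq M0 s00 g00 udu duM.
have ns0 : s0 != 0 by rewrite gt_eqF.
have ng0 : g0 != 0 by rewrite gt_eqF.
set k := - (s0 / g0 * e).
have kdM : {ae mu, forall x, p <= x <= q -> `|k * du x| <= `|k| * M}.
  apply: filterS duM => x duM xpq.
  by rewrite normrM ler_wpM2l// duM.
have := primitive_expR pq (mulr_ge0 (normr_ge0 k) M0) (primitiveZ k udu) kdM.
move=> /(primitiveZ (C / s0))[Hi HE].
have fE : (fun t => C / s0 * (expR (k * u t) * (k * du t))) =
    (fun t => - (e * C / g0) * (expR (k * u t) * du t)).
  by apply/funext => t; rewrite {2}/k; field; rewrite ns0 ng0.
rewrite fE in Hi HE; split => // s t ps st tq; rewrite -HE//.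
by rewrite /hyst_arc -/k; field.
Qed.

(** Monotonicity gives [|du| = e * du] almost everywhere, so [w] solves the limit equation and
    [error_drift] applies to [z - w] and to its negative. The loss rate is proportional to [|du|],
    so it integrates to a multiple of the variation [e * (u q - u p)], whatever [gamma] is. *)
Lemma piece_estimate (s0 gamma e C e1 W delta B p q M : R) (g u du z : R -> R) :
  p <= q -> 0 <= M -> 0 < s0 -> (forall th, 0 < g th) -> (e = 1 \/ e = -1) ->
  primitive u du p q -> {ae mu, forall x, p <= x <= q -> `|du x| <= M} ->
  (forall x y, p <= x -> x <= y -> y <= q -> e * u x <= e * u y) ->
  primitive z (lugre_rhs s0 g du gamma z) p q ->
  {ae mu, forall x, p <= x <= q -> `|g (du x / gamma) - g 0| <= e1} -> e1 <= g 0 ->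
  0 <= delta ->
  let w := fun t => hyst_arc (s0 / g 0) (g 0) e C (u t) / s0 in
  (forall t, p <= t <= q -> `|w t| <= W) ->
  e1 * W / g 0 + delta <= B -> `|z p - w p| <= B ->
  (forall t, p <= t <= q -> `|z t - w t| <= B) /\
  `|z q - w q| <= Num.max (e1 * W / g 0 + delta)
                     (B - delta * s0 / (2 * g 0) * (e * (u q - u p))).
Proof.
move=> pq M0 s00 gp e1P udu duM umono zr gE e1g d0 w wW etaB vB.
have g00 := gp 0.
have wr := primitive_arc e C pq M0 s00 g00 udu duM.
have vr := primitiveB zr wr; rewrite -/w in vr.
have e2 : e * e = 1 by case: e1P => ->; ring.
have edu := primitive_nondecr_ae_ge0 (primitiveZ e udu) umono.
have absdu x : 0 <= e * du x -> `|du x| = e * du x.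
  case: e1P => ->; rewrite ?mul1r ?mulN1r; first by move/ger0_norm.
  by rewrite oppr_ge0 => /ler0_norm.
pose K := delta * s0 / (2 * g 0).
have K0 : 0 <= K by rewrite divr_ge0 ?mulr_ge0// ltW.
pose b x := K * (e * du x).
have [bi bE] := primitiveZ K (primitiveZ e udu).
have b0 : {ae mu, forall x, p <= x <= q -> 0 <= b x}.
  by apply: filterS edu => x edu xpq; rewrite mulr_ge0 ?edu.
set r := (X in primitive _ X) in vr.
(* The forcing terms [du] cancel in the difference of the two equations; only the damping terms
   remain. *)
have rE x : 0 <= e * du x ->
    r x = - s0 * `|du x| / g (du x / gamma) * z x + s0 / g 0 * `|du x| * w x.
  move=> /absdu dE; rewrite /r /lugre_rhs /w /hyst_arc dE.
  have := gp (du x / gamma); set G := g _ => G0; set X := expR _.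
  by case: e1P => ->; field; rewrite !gt_eqF.
have drift_up : {ae mu, forall x, p <= x <= q ->
    e1 * W / g 0 + delta <= z x - w x -> r x <= - b x}.
  apply: filterS2 edu gE => x edu gE xpq vx.
  rewrite rE ?edu// /b -absdu ?edu//; exact: (error_drift s00 g00 (gp _) (gE xpq) e1g _ (wW _ xpq)).
have drift_down : {ae mu, forall x, p <= x <= q ->
    e1 * W / g 0 + delta <= -1 * (z x - w x) -> -1 * r x <= - b x}.
  apply: filterS2 edu gE => x edu gE xpq vx.
  (* The equations are odd in the state: the lower bound is the upper one for [- z] and [- w]. *)
  have := @error_drift s0 (g 0) (g (du x / gamma)) e1 `|du x| (- z x) (- w x) W delta.
  rewrite normrN rE ?edu// /b -absdu ?edu// !mulrN.
  move=> /(_ s00 g00 (gp _) (gE xpq) e1g (normr_ge0 _) (wW x xpq) d0 _).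
  move=> H; have /H : e1 * W / g 0 + delta <= - z x - - w x by lra.
  by rewrite -/K; lra.
have vr' := primitiveZ (-1) vr.
have bI : \int[mu]_(x in `[p, q]) b x = K * (e * (u q - u p)).
  by rewrite -bE//; ring.
split.
  move=> t tpq; rewrite ler_norml; apply/andP; split; last first.
    apply: (barrier pq vr _ etaB) => //; last by rewrite (le_trans (ler_norm _)).
    apply: filterS2 drift_up b0 => x H1 H2 xpq vx.
    by have := H1 xpq vx; have := H2 xpq; lra.
  rewrite lerNl -mulN1r; apply: (barrier pq vr' _ etaB) => //.
    apply: filterS2 drift_down b0 => x H1 H2 xpq vx.
    by have := H1 xpq vx; have := H2 xpq; lra.
  by rewrite mulN1r (le_trans (ler_norm _))// normrN.
have := barrier_decay pq vr bi b0 drift_up.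
have := barrier_decay pq vr' bi b0 drift_down.
rewrite -/b bI ler_norml=> /(_ B) H1 /(_ B) H2; apply/andP; split.
  by rewrite lerNl -mulN1r; apply: H1; rewrite mulN1r (le_trans (ler_norm _))// normrN.
by apply: H2; rewrite (le_trans (ler_norm _)).
Qed.

(** * Uniform estimates over all pieces and passage to the limit *)

Lemma ae_le_within (F G : R -> R) p q c : p < q ->
  {within `[p, q], continuous F} -> {within `[p, q], continuous G} ->
  {ae mu, forall x, p <= x <= q -> `|F x - G x| <= c} ->
  forall t, p <= t <= q -> `|F t - G t| <= c.
Proof.
move=> pq /within_itvP Fc /within_itvP Gc H t tpq.
apply: contrapT => /negP; rewrite -ltNge => ct.
(* Each function may move by half the excess over [c]. The bound then fails on an open interval
   inside [[p, q]], also when [t] is an endpoint, and this interval contains a point where the bound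
   holds. *)
pose e := (`|F t - G t| - c) / 2.
have e0 : 0 < e by rewrite divr_gt0//; lra.
have [d1 d10 H1] := Fc t tpq e e0.
have [d2 d20 H2] := Gc t tpq e e0.
have : Num.max p (Num.max (t - d1) (t - d2)) < Num.min q (Num.min (t + d1) (t + d2)).
  by rewrite !gt_max !lt_min; lra.
move=> /ae_itv_dense/(_ H)[x]; rewrite !gt_max !lt_min => xI Hx.
have xpq : p <= x <= q by lra.
have := H1 x xpq; have := H2 x xpq; have := Hx xpq; rewrite !ltr_norml.
move=> Fx /(_ _) G1 /(_ _) F1.
have {}G1 : - e < G t - G x < e by apply: G1; lra.
have {}F1 : - e < F t - F x < e by apply: F1; lra.
have : `|F t - G t| < `|F x - G x| + (e + e); last by rewrite /e; lra.
have -> : F t - G t = (F x - G x) + ((F t - F x) - (G t - G x)) by ring.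
apply: le_lt_trans (ler_normD _ _) _; rewrite ltrD2l ltr_norml; lra.
Qed.

Lemma arc_bound (s0 g0 e C Cb Mu x : R) : 0 < s0 -> 0 < g0 -> (e = 1 \/ e = -1) ->
  `|C| <= Cb -> `|x| <= Mu ->
  `|hyst_arc (s0 / g0) g0 e C x / s0| <= (g0 + Cb * expR (s0 / g0 * Mu)) / s0.
Proof.
move=> s00 g00 e1P CCb xMu.
rewrite normrM normfV (gtr0_norm s00) ler_pM2r ?invr_gt0//.
apply: le_trans (ler_normD _ _) _; rewrite !normrM (gtr0_norm g00) (gtr0_norm (expR_gt0 _)).
have -> : `|e| = 1 by case: e1P => ->; rewrite ?normrN normr1.
rewrite mul1r lerD2l ler_pM ?expR_ge0// ler_expR.
apply: le_trans (ler_norm _) _; rewrite normrM normrN normrM.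
have -> : `|e| = 1 by case: e1P => ->; rewrite ?normrN normr1.
by rewrite mulr1 gtr0_norm ?divr_gt0// ler_wpM2l// divr_ge0// ltW.
Qed.

(** Since the arcs match at the nodes, each piece hands its final error over to the next one. By
    induction the bound drops by a fixed amount per piece until it reaches the radius. *)
Lemma pieces_estimate (s0 gamma e1 W delta B m M : R) (g u du z : R -> R)
    (P e C : nat -> R) :
  (forall n, P n <= P n.+1) -> 0 <= M -> 0 < s0 -> (forall th, 0 < g th) ->
  (forall n, e n = 1 \/ e n = -1) ->
  (forall n, primitive u du (P n) (P n.+1)) ->
  (forall n, {ae mu, forall x, P n <= x <= P n.+1 -> `|du x| <= M}) ->
  (forall n x y, P n <= x -> x <= y -> y <= P n.+1 -> e n * u x <= e n * u y) ->
  (forall n, primitive z (lugre_rhs s0 g du gamma z) (P n) (P n.+1)) ->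
  (forall n, {ae mu, forall x, P n <= x <= P n.+1 -> `|g (du x / gamma) - g 0| <= e1}) ->
  e1 <= g 0 -> 0 <= delta ->
  let w := fun n t => hyst_arc (s0 / g 0) (g 0) (e n) (C n) (u t) / s0 in
  (forall n t, P n <= t <= P n.+1 -> `|w n t| <= W) ->
  (forall n, w n (P n.+1) = w n.+1 (P n.+1)) ->
  (forall n, m <= e n * (u (P n.+1) - u (P n))) ->
  `|z (P 0%N) - w 0%N (P 0%N)| <= B ->
  forall n t, P n <= t <= P n.+1 ->
  `|z t - w n t| <= Num.max (e1 * W / g 0 + delta)
                     (B - n%:R * (delta * s0 / (2 * g 0) * m)).
Proof.
move=> Pn M0 s00 gp e1P udu duM umono zr gE e1g d0 w wW joint um vB.
set eta := e1 * W / g 0 + delta.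
set K := delta * s0 / (2 * g 0).
have K0 : 0 <= K by rewrite divr_ge0 ?mulr_ge0// ltW// mulr_gt0.
have step n B' := piece_estimate (C := C n) (B := B')
  (Pn n) M0 s00 gp (e1P n) (udu n) (duM n) (umono n) (zr n) (gE n) e1g d0 (wW n).
have node n : `|z (P n) - w n (P n)| <= Num.max eta (B - n%:R * (K * m)).
  elim: n => [|n IH]; first by rewrite mul0r subr0 le_max vB orbT.
  have [|_] := step n (Num.max eta (B - n%:R * (K * m))) _ IH.
    by rewrite le_max lexx.
  rewrite -/(w n (P n.+1)) joint => /le_trans; apply.
  rewrite ge_max le_max lexx/= -/K.
  have Km : K * m <= K * (e n * (u (P n.+1) - u (P n))) by rewrite ler_wpM2l.
  have Km0 : 0 <= K * (e n * (u (P n.+1) - u (P n))).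
    by rewrite mulr_ge0// mulrBr subr_ge0 umono.
  set b := Num.max eta (B - n.+1%:R * (K * m)).
  have b1 : eta <= b by rewrite le_max lexx.
  have b2 : B - n.+1%:R * (K * m) <= b by rewrite le_max lexx orbT.
  move: b2; rewrite -natr1 mulrDl mul1r => b2.
  by rewrite lerBlDr ge_max; apply/andP; split; lra.
move=> n t tn; apply: (step n _ _ (node n)).1 tn.
by rewrite le_max lexx.
Qed.

Lemma continuous_at0_slow (h du : R -> R) M e1 : continuous h -> 0 < e1 -> 0 <= M ->
  {ae mu, forall x, 0 <= x -> `|du x| <= M} ->
  exists G, forall gamma, G <= gamma -> 0 < gamma ->
  {ae mu, forall x, 0 <= x -> `|h (du x / gamma) - h 0| <= e1}.
Proof.
move=> hc e10 M0 duM.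
have /cvgrPdist_lt/(_ _ e10)/nbhs_ballP[d /= d0 H] := hc 0.
(* The [+ 1] makes [M < d * gamma] strict. *)
exists ((M + 1) / d) => gamma Gg g0; apply: filterS duM => x duM x0.
rewrite distrC; apply: ltW; apply: H.
rewrite /ball/= sub0r normrN normrM normfV (gtr0_norm g0) ltr_pdivrMr//.
apply: le_lt_trans (duM x0) _.
move: Gg; rewrite ler_pdivrMr// mulrC; lra.
Qed.

(** The errors from the state, from its derivative and from [f] each get [eps / 4]. The number [N]
    of pieces to wait depends only on the initial error and on the guaranteed loss per piece, so it
    is the same for all large [gamma]; this is what allows the limits in [gamma] and in the period
    to be combined. *)
Lemma output_estimate (s0 s1 x0 Cb m : R) (g f u du : R -> R) (z : R -> R -> R)
    (P e C : nat -> R) :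
  0 < s0 -> 0 < s1 -> continuous g -> (forall th, 0 < g th) ->
  continuous f -> f 0 = 0 -> W1inf_with_deriv u du ->
  P 0%N = 0 -> (forall n, P n <= P n.+1) -> (forall n, e n = 1 \/ e n = -1) ->
  (forall n, `|C n| <= Cb) ->
  (forall n x y, P n <= x -> x <= y -> y <= P n.+1 -> e n * u x <= e n * u y) ->
  (forall n, hyst_arc (s0 / g 0) (g 0) (e n) (C n) (u (P n.+1)) =
             hyst_arc (s0 / g 0) (g 0) (e n.+1) (C n.+1) (u (P n.+1))) ->
  0 < m -> (forall n, m <= e n * (u (P n.+1) - u (P n))) ->
  (forall gamma, 0 < gamma -> caratheodory_sol s0 g du gamma x0 (z gamma)) ->
  forall eps, 0 < eps -> exists (G : R) (N : nat),
  forall gamma, G <= gamma -> 0 < gamma -> forall n, (N <= n)%N ->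
  {ae mu, forall t, P n <= t <= P n.+1 ->
     `|lugre_output s0 s1 g f du gamma (z gamma) t -
       hyst_arc (s0 / g 0) (g 0) (e n) (C n) (u t)| <= eps}.
Proof.
move=> s00 s10 gc gp fc f0 [_ [M1 duM1] [Mu uMu] uE] P0 Pn e1P CCb umono joint m0 um zE eps eps0.
have g00 := gp 0; have ng0 : g 0 != 0 by rewrite gt_eqF.
have ns0 : s0 != 0 by rewrite gt_eqF.
pose M := `|M1|; have M0 : 0 <= M := normr_ge0 _.
have duM : {ae mu, forall x, 0 <= x -> `|du x| <= M}.
  by apply: filterS duM1 => x H x0'; apply: le_trans (H x0') (ler_norm _).
have Pge0 n : 0 <= P n by elim: n => [|n IH]; rewrite ?P0// (le_trans IH).
have restr (Q : R -> Prop) n : {ae mu, forall x, 0 <= x -> Q x} ->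
    {ae mu, forall x, P n <= x <= P n.+1 -> Q x}.
  by apply: filterS => x H xP; apply: H; have := Pge0 n; lra.
pose w n t := hyst_arc (s0 / g 0) (g 0) (e n) (C n) (u t) / s0.
pose W := (g 0 + Cb * expR (s0 / g 0 * Mu)) / s0.
have Cb0 : 0 <= Cb by apply: le_trans (CCb 0%N).
have W0 : 0 < W.
  by rewrite divr_gt0// ltr_wpDr// mulr_ge0// expR_ge0.
have wW n t : P n <= t <= P n.+1 -> `|w n t| <= W.
  by move=> tP; apply: arc_bound => //; apply: uMu; have := Pge0 n; lra.
pose delta := eps / (8 * s0).
have delta0 : 0 < delta by rewrite divr_gt0 ?mulr_gt0.
(* The first bound keeps [g (du t / gamma)] above [g 0 / 2]; the second makes the radius
   [e1 * W / g 0] at most [delta]. *)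
pose e1 := Num.min (g 0 / 2) (eps * g 0 / (8 * s0 * W)).
have e10 : 0 < e1.
  by rewrite lt_min; apply/andP; split; do ?[apply: divr_gt0 => //|apply: mulr_gt0 => //].
have e1g : e1 <= g 0 / 2 by rewrite ge_min lexx.
have e1W : e1 * W / g 0 <= eps / (8 * s0).
  rewrite ler_pdivrMr// -ler_pdivlMr//.
  have -> : eps / (8 * s0) * g 0 / W = eps * g 0 / (8 * s0 * W).
    by field; rewrite ns0 gt_eqF.
  by rewrite ge_min lexx orbT.
pose eta := e1 * W / g 0 + delta.
have eta0 : 0 <= eta.
  apply: addr_ge0; last exact: ltW.
  by rewrite divr_ge0 ?(ltW g00)// mulr_ge0// ltW.
have s0eta : s0 * eta <= eps / 4.
  have -> : eps / 4 = s0 * (eps / (8 * s0) + delta) by rewrite /delta; field.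
  by rewrite ler_wpM2l ?lerD2r// ltW.
(* A bound for [z'] once [z] is within [eta] of [w], using [g (du t / gamma) >= g 0 / 2]. *)
pose X := s0 * M / (g 0 / 2) * (eta + W) + M.
have X0 : 0 <= X.
  apply: addr_ge0 => //; apply: mulr_ge0; last by rewrite addr_ge0// ltW.
  by apply: divr_ge0; [rewrite mulr_ge0// ltW|rewrite divr_ge0// ltW].
have [Gg HGg] := continuous_at0_slow gc e10 M0 duM.
have eps4 : 0 < eps / 4 by rewrite divr_gt0.
have [Gf HGf] := continuous_at0_slow fc eps4 M0 duM.
pose B := `|x0 - w 0%N 0|.
pose K := delta * s0 / (2 * g 0) * m.
have K0 : 0 < K by rewrite !mulr_gt0// invr_gt0 mulr_gt0.
(* More than [B / K] losses of [K] exhaust the initial error [B]; the last threshold on [gamma]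
   makes [s1 / gamma * X] at most [eps / 4]. *)
exists (Num.max Gg (Num.max Gf (s1 * X / (eps / 4)))), (Num.truncn (B / K)).+1.
move=> gamma; rewrite !ge_max => /andP[gG /andP[gF gX]] gam0 n Nn.
have gE := HGg gamma gG gam0; have fE := HGf gamma gF gam0.
have zc := zE gamma gam0.
have z0 : z gamma 0 = x0.
  by rewrite (zc 0 _).2// set_itv1 Rintegral_set1 addr0.
have zw t : P n <= t <= P n.+1 -> `|z gamma t - w n t| <= eta.
  move=> tP.
  have H : `|z gamma t - w n t| <= Num.max (e1 * W / g 0 + delta) (B - n%:R * K).
    apply: (pieces_estimate (M := M)) => //.
    - by move=> k; exact: (primitive_from0 (Pge0 k) uE (Pn k)).
    - by move=> k; exact: restr.
    - by move=> k; exact: (primitive_from0 (Pge0 k) zc (Pn k)).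
    - by move=> k; exact: restr.
    - lra.
    - exact: ltW.
    - by move=> k; rewrite joint.
    - by rewrite P0 z0.
  apply: le_trans H _; rewrite ge_max lexx/=.
  have : B / K < n%:R.
    apply: lt_le_trans (_ : (Num.truncn (B / K)).+1%:R <= _); last by rewrite ler_nat.
    exact: truncnS_gt.
  rewrite ltr_pdivrMr// => H'; lra.
apply: filterS3 (restr _ n duM) (restr _ n gE) (restr _ n fE) => t tM tg tf tP.
have {}tM := tM tP; have {}tg := tg tP; have {}tf := tf tP.
have {}zw := zw t tP; have {}wW := wW n t tP.
rewrite f0 subr0 in tf.
rewrite /lugre_output.
have -> : hyst_arc (s0 / g 0) (g 0) (e n) (C n) (u t) = s0 * w n t.
  by rewrite /w; field.
set rhs := lugre_rhs _ _ _ _ _ _.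
have zb : `|z gamma t| <= eta + W.
  have -> : z gamma t = (z gamma t - w n t) + w n t by ring.
  by apply: le_trans (ler_normD _ _) _; rewrite lerD.
have gt : g 0 / 2 <= g (du t / gamma) by move: tg; rewrite ler_norml; lra.
have rhsX : `|rhs| <= X.
  apply: le_trans (ler_normD _ _) _; rewrite lerD//.
  rewrite !normrM normfV normrN normr_id (gtr0_norm s00) (gtr0_norm (gp _)).
  rewrite ler_pM ?mulr_ge0 ?invr_ge0// ?(ltW (gp _)) ?(ltW s00)//.
  rewrite ler_pM ?mulr_ge0 ?invr_ge0// ?(ltW (gp _)) ?(ltW s00)//.
    by rewrite ler_wpM2l// ltW.
  by rewrite lef_pV2 ?posrE ?divr_gt0.
have T2 : `|s1 / gamma * rhs| <= eps / 4.
  rewrite normrM gtr0_norm ?divr_gt0//.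
  have : s1 / gamma * `|rhs| <= s1 / gamma * X by rewrite ler_wpM2l// divr_ge0// ltW.
  move=> /le_trans; apply.
  by rewrite mulrAC ler_pdivrMr// [leRHS]mulrC -ler_pdivrMr.
have -> : s0 * z gamma t + s1 / gamma * rhs + f (du t / gamma) - s0 * w n t =
  s0 * (z gamma t - w n t) + s1 / gamma * rhs + f (du t / gamma) by ring.
apply: le_trans (ler_normD _ _) _.
have := ler_normD (s0 * (z gamma t - w n t)) (s1 / gamma * rhs).
have : `|s0 * (z gamma t - w n t)| <= s0 * eta.
  by rewrite normrM gtr0_norm// ler_wpM2l// ltW.
lra.
Qed.

Lemma within_continuous_hyst_arc (a g0 e C p q : R) (u : R -> R) :
  {within `[p, q], continuous u} ->
  {within `[p, q], continuous (fun t => hyst_arc a g0 e C (u t))}.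
Proof.
move=> /within_itvP uc; apply/within_itvP => x xpq eps eps0.
have ac : continuous (hyst_arc a g0 e C).
  move=> y; apply: cvgD; first exact: cvg_cst.
  apply: cvgM; first exact: cvg_cst.
  apply: (@continuous_comp _ _ _ (fun y => - (a * e) * y) expR).
    by apply: cvgM; [exact: cvg_cst|exact: cvg_id].
  exact: continuous_expR.
have /cvgrPdist_lt/(_ _ eps0)/nbhs_ballP[d1 /= d10 H1] := ac (u x).
have [d d0 H] := uc x xpq d1 d10.
by exists d => // y ypq xy; apply: H1; apply: H.
Qed.

(* [q] lists the four turning points of one period and [P] those of all periods. *)
Lemma limit_loop (s0 s1 x0 T m : R) (g f u du : R -> R) (z : R -> R -> R)
    (ystar yo : R -> R) (q C : nat -> R) :
  0 < s0 -> 0 < s1 -> continuous g -> (forall th, 0 < g th) ->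
  continuous f -> f 0 = 0 -> W1inf_with_deriv u du ->
  (forall t, 0 <= t -> u (t + T) = u t) ->
  q 0%N = 0 -> q 4%N = T -> (forall i, (i < 4)%N -> q i < q i.+1) ->
  (forall i, (i < 4)%N -> forall x y, q i <= x -> x <= y -> y <= q i.+1 ->
     (-1) ^+ i * u x <= (-1) ^+ i * u y) ->
  (forall i, (i < 4)%N ->
     hyst_arc (s0 / g 0) (g 0) ((-1) ^+ i) (C i) (u (q i.+1)) =
     hyst_arc (s0 / g 0) (g 0) ((-1) ^+ (i.+1 %% 4)) (C (i.+1 %% 4)%N) (u (q i.+1))) ->
  0 < m -> (forall i, (i < 4)%N -> m <= (-1) ^+ i * (u (q i.+1) - u (q i))) ->
  (forall gamma, 0 < gamma -> caratheodory_sol s0 g du gamma x0 (z gamma)) ->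
  Linf_cvg_gamma (fun gamma => lugre_output s0 s1 g f du gamma (z gamma)) ystar ->
  Linf_cvg_periods ystar T yo ->
  {within `[0, T], continuous yo} ->
  forall i t, (i < 4)%N -> q i <= t <= q i.+1 ->
  yo t = hyst_arc (s0 / g 0) (g 0) ((-1) ^+ i) (C i) (u t).
Proof.
move=> s00 s10 gc gp fc f0 uW uT q0 q4 qlt umono joint m0 um zE yg yk yoc i t i4 tq.
pose P n := q (n %% 4)%N + (n %/ 4)%:R * T.
have mod4 n : (n %% 4 < 4)%N by rewrite ltn_pmod.
have PS n : P n.+1 = q (n %% 4).+1 + (n %/ 4)%:R * T.
  rewrite /P {1 2}(divn_eq n 4) -addnS modnMDl divnMDl//.
  (* The last piece of a period ends at [q 4 = T], the first node of the next period. *)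
  have := mod4 n; rewrite ltnS leq_eqVlt => /predU1P[->|].
    by rewrite q0 q4 addn1 -natr1; ring.
  by rewrite -(ltn_add2r 1) !addn1 => n3; rewrite (modn_small n3) (divn_small n3) addn0.
have qge0 j : (j <= 4)%N -> 0 <= q j.
  elim: j => [|j IH] j4; first by rewrite q0.
  by rewrite (le_trans (IH (ltnW j4)))// ltW// qlt.
have qle4 j : (j <= 4)%N -> q j <= T.
  move=> j4; rewrite -q4 -(subKn j4); move: (4 - j)%N => k.
  elim: k => [|k IH]; first by rewrite subn0.
  case: (ltnP k 4) => k4; last by rewrite (_ : 4 - k.+1 = 4 - k)%N//; lia.
  apply: le_trans IH; rewrite (_ : (4 - k)%N = (4 - k.+1).+1); last by lia.
  by rewrite ltW// qlt//; lia.
have T0 : 0 <= T by rewrite -q4 qge0.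
have ukT k x : 0 <= x -> u (x + k%:R * T) = u x.
  move=> x0'; elim: k => [|k IH]; first by rewrite mul0r addr0.
  by rewrite -natr1 mulrDl mul1r addrA uT// addr_ge0// mulr_ge0.
have uP n : u (P n) = u (q (n %% 4)%N) by rewrite /P ukT// qge0// ltnW.
have uPS n : u (P n.+1) = u (q (n %% 4).+1) by rewrite PS ukT// qge0.
pose e n : R := (-1) ^+ (n %% 4).
pose Cn n := C (n %% 4)%N.
have e1P n : e n = 1 \/ e n = -1.
  by rewrite /e -signr_odd; case: (odd _); [right|left].
have PnS n : P n <= P n.+1 by rewrite PS lerD2r ltW// qlt.
have CCb n : `|Cn n| <= \sum_(j < 4) `|C j|.
  rewrite (bigD1 (Ordinal (mod4 n)))//= lerDl sumr_ge0//.
have Pmono n x y : P n <= x -> x <= y -> y <= P n.+1 -> e n * u x <= e n * u y.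
  rewrite PS /P => Px xy yP; set k := (n %/ 4)%:R * T in Px yP.
  have qn := qge0 _ (ltnW (mod4 n)).
  have -> : x = (x - k) + k by ring.
  have -> : y = (y - k) + k by ring.
  by rewrite !ukT; [apply: umono => //; lra|lra|lra].
have Pjoint n : hyst_arc (s0 / g 0) (g 0) (e n) (Cn n) (u (P n.+1)) =
    hyst_arc (s0 / g 0) (g 0) (e n.+1) (Cn n.+1) (u (P n.+1)).
  rewrite uPS /e /Cn joint//.
  by have -> : (n.+1 %% 4 = (n %% 4).+1 %% 4)%N by lia.
have Pm n : m <= e n * (u (P n.+1) - u (P n)) by rewrite uPS uP um.
have P0 : P 0%N = 0 by rewrite /P q0 mul0r addr0.
have est := output_estimate s00 s10 gc gp fc f0 uW P0 PnS e1P CCb Pmono Pjoint m0 Pm zE.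
have qi0 := qge0 _ (ltnW i4); have qiT := qle4 _ i4.
have [_ _ _ uE] := uW.
have qi := ltW (qlt _ i4).
have arcc : {within `[q i, q i.+1], continuous
    (fun t => hyst_arc (s0 / g 0) (g 0) ((-1) ^+ i) (C i) (u t))}.
  apply: within_continuous_hyst_arc.
  exact: primitive_continuous (primitive_from0 qi0 uE qi) qi.
have yoc' : {within `[q i, q i.+1], continuous yo}.
  by apply: continuous_subspaceW yoc; apply: subset_itvScc; rewrite bnd_simp.
(* The gap between [yo] and the arc is split into thirds through the output for one large [gamma]
   and through [ystar]. *)
apply/eqP; rewrite -subr_eq0 -normr_le0; apply/ler_addgt0Pl => eps eps0.
rewrite addr0.
have eps3 : 0 < eps / 3 by rewrite divr_gt0.
have [G1 [N HN]] := est _ eps3.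
have [G2 HG2] := yg _ eps3.
have [K HK] := yk _ eps3.
pose gamma := Num.max 1 (Num.max G1 G2).
have gam0 : 0 < gamma by rewrite lt_max ltr01.
have gG1 : G1 <= gamma by rewrite !le_max lexx orbT.
have gG2 : G2 <= gamma by rewrite !le_max lexx !orbT.
(* Period [k] is late enough for [yo], and its pieces, numbered from [4 * k], come after the first
   [N]. *)
pose k := maxn N K.
pose n := (k * 4 + i)%N.
have n4 : (n %% 4 = i)%N by rewrite /n modnMDl modn_small.
have nd : (n %/ 4 = k)%N by rewrite /n divnMDl// divn_small// addn0.
have Nn : (N <= n)%N 
  by rewrite (leq_trans (leq_maxl N K))// (leq_trans (leq_pmulr k (ltn0Sn 3)))// leq_addr.
have := HN gamma gG1 gam0 n Nn; rewrite PS /P /e /Cn n4 nd => Hn.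
(* The almost everywhere bounds on period [k] are translated back to [[0, T]]; continuity then
   yields the bound at [t] itself. *)
apply: ae_le_within (qlt _ i4) yoc' arcc _ _ tq.
apply: filterS3 (ae_shift (k%:R * T) Hn) (ae_shift (k%:R * T) (HG2 gamma gG2 gam0))
  (HK k (leq_maxr _ _)) => x H1 H2 H3 xq.
have x0' : 0 <= x by lra.
rewrite lerD2r ukT// in H1.
have {}H1 := H1 _; have {}H2 := H2 _; have {}H3 := H3 _.
set Y := lugre_output _ _ _ _ _ _ _ _ in H1 H2.
set A := hyst_arc _ _ _ _ _ in H1 *.
set S := ystar _ in H2 H3.
have -> : yo x - A = - (S - yo x) + (- (Y - S) + (Y - A)) by ring.
apply: le_trans (ler_normD _ _) _; rewrite normrN.
have := ler_normD (- (Y - S)) (Y - A); rewrite normrN.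
have : `|Y - A| <= eps / 3 by apply: H1; lra.
have : `|Y - S| <= eps / 3 by apply: H2; rewrite addr_ge0// mulr_ge0.
have : `|S - yo x| <= eps / 3 by apply: H3; lra.
lra.
Qed.

(** * Reparametrization of the loops and periodicity of the explicit formula *)

Lemma itv_cc_setU p s q : p <= s -> s <= q ->
  `[p, q]%classic = `[p, s]%classic `|` `[s, q]%classic.
Proof.
move=> ps sq; apply/seteqP; split => x /=; rewrite !in_itv/=; last by case; lra.
by have [xs|xs] := leP x s; [left|right]; lra.
Qed.

(** [F] serves as a clock: monotonicity keeps its readings in the target interval, and the
    intermediate value theorem shows that all of them occur. *)
Lemma image_reparam (X : Type) (phi chi : R -> X) F p q rho : p <= q ->
  {within `[p, q], continuous F} ->
  (forall x y, p <= x -> x <= y -> y <= q -> F x <= F y) ->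
  (forall t, p <= t <= q -> chi (rho + (F t - F p)) = phi t) ->
  [set phi t | t in `[p, q]] = [set chi s | s in `[rho, rho + (F q - F p)]].
Proof.
move=> pq Fc Fmono chiE; have Fpq := Fmono p q (lexx _) pq (lexx _).
apply/seteqP; split => _ [t tI <-]; move: tI; rewrite /= in_itv/= => tI.
  exists (rho + (F t - F p)); last exact: chiE.
  rewrite /= in_itv/=; have := Fmono p t; have := Fmono t q; lra.
have [|c] := @IVT _ F p q (F p + (t - rho)) pq Fc.
  by rewrite min_l ?max_r//; lra.
rewrite in_itv/= => cI Fct; exists c; first by rewrite /= in_itv.
by rewrite -chiE// Fct; congr chi; ring.
Qed.

(** The parameter [rho + (-1) ^+ i * (x - ui)] is where a branch of slope [(-1) ^+ i] starting from
    [ui] at [rho] takes the value [x]; this turns a formula in the variation into one in the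
    input. *)
Lemma ypiece_hyst_arc (a g0 rho Y ui x : R) (i : nat) :
  ypiece a g0 i rho Y (rho + (-1) ^+ i * (x - ui)) =
  hyst_arc a g0 ((-1) ^+ i)
    ((Y - (-1) ^+ i * g0) * expR (a * (-1) ^+ i * ui)) x.
Proof.
rewrite /ypiece /hyst_arc; set e := (-1) ^+ i.
have -> : rho + e * (x - ui) - rho = e * (x - ui) by ring.
have H1 : expR (a * e * ui) * expR (- (a * e) * x) = expR (- a * (e * (x - ui))).
  by rewrite -expRD; congr expR; ring.
have H2 : expR (- a * (e * (x - ui))) * expR (a * (e * (x - ui))) = 1.
  by rewrite -expRD -[RHS]expR0; congr expR; ring.
rewrite -[_ * expR _ * expR _]mulrA H1; move: H2.
set E := expR _; set E' := expR _ => H2.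
have -> : E * (Y + e * g0 * (E' - 1)) = e * g0 * (E * E') + (Y - e * g0) * E by ring.
by rewrite H2 mulr1.
Qed.

Lemma ypiece_base (a g0 rho Y : R) (i : nat) : ypiece a g0 i rho Y rho = Y.
Proof. by rewrite /ypiece subrr !mulr0 expR0 subrr mulr0 addr0 mul1r. Qed.

(** Each piece is affine in its initial value, and the four compose to an affine map of slope
    [expR (- a * r4)], which is below 1; [Y0] is its fixed point. *)
Lemma ypiece_periodic (a g0 r1 r2 r3 r4 : R) : 0 < a -> 0 < r4 ->
  let Y0 := g0 * (expR (- a * r4) / (1 - expR (- a * r4))) *
            (2 * expR (a * r1) - 2 * expR (a * r2) + 2 * expR (a * r3)
             - expR (a * r4) - 1) in
  let Y1 := ypiece a g0 0 0 Y0 r1 in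
  let Y2 := ypiece a g0 1 r1 Y1 r2 in
  let Y3 := ypiece a g0 2 r2 Y2 r3 in
  ypiece a g0 3 r3 Y3 r4 = Y0.
Proof.
move=> a0 r40; rewrite /ypiece subr0 !mulNr !mulrBr !expRN !expRB.
have E4 : 1 < expR (a * r4) by rewrite expR_gt1 mulr_gt0.
have := expR_gt0 (a * r1); have := expR_gt0 (a * r2); have := expR_gt0 (a * r3).
set E1 := expR (a * r1); set E2 := expR (a * r2); set E3 := expR (a * r3).
set X4 := expR (a * r4) in E4 *.
move=> e3 e2 e1 /=.
field.
rewrite !gt_eqF//=; lra.
Qed.

End LuGreLoop.

(** The convergence determines [yo] only up to null sets, whereas the loops are sets of pointwise
    values; continuity selects the representative. *)
Theorem theoremA (R : realType) (sigma0 sigma1 : R) (g f : R -> R) (x0 : R)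
  (umin1 umax1 umin2 umax2 t1 t2 t3 t4 t5 : R) (u du : R -> R)
  (z : R -> R -> R) (ystar yo : R -> R) :
  0 < sigma0 -> 0 < sigma1 ->
  continuous g -> (forall th, 0 < g th) ->
  continuous f -> f 0 = 0 ->
  umin1 <= umin2 -> umin2 < umax1 -> umax1 <= umax2 ->
  (umin1 != umin2 \/ umax1 != umax2) ->
  0 < t1 -> t1 < t2 -> t2 < t3 -> t3 < t4 ->
  W1inf_with_deriv u du ->
  bimodal_input u t1 t2 t3 t4 umin1 umax1 umin2 umax2 ->
  (forall gamma, 0 < gamma -> caratheodory_sol sigma0 g du gamma x0 (z gamma)) ->
  Linf_cvg_gamma (fun gamma => lugre_output sigma0 sigma1 g f du gamma (z gamma))
    ystar ->
  Linf_cvg_periods ystar t4 yo ->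
  {within `[0, t4], continuous yo} ->
  t2 < t5 -> t5 <= t3 -> u t5 = u t1 ->
  [set (u t, yo t) | t in `[0, t4]] =
    [set (psi_u umin1 umax1 umin2 umax2 t, ycirc sigma0 g umin1 umax1 umin2 umax2 t)
      | t in `[0, rho4 umin1 umax1 umin2 umax2]]
  /\
  [set (u t, yo t) | t in `[t1, t5]] =
    [set (psi_u umin1 umax1 umin2 umax2 t, ycirc sigma0 g umin1 umax1 umin2 umax2 t)
      | t in `[rho1 umin1 umax1 umin2 umax2, rho5 umin1 umax1 umin2 umax2]].
Proof.
move=> s00 s10 gc gp fc f0 h1 h2 h3 _ t10 t12 t23 t34 uW
  [uT [inc0 dec1 inc2 dec3] [u0 u1 u2 u3 u4]] zE yg yk yoc t25 t53 u5.
have g00 := gp 0.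
set r1 := rho1 umin1 umax1 umin2 umax2; set r4 := rho4 umin1 umax1 umin2 umax2.
pose r2 := rho2 umin1 umax1 umin2 umax2; pose r3 := rho3 umin1 umax1 umin2 umax2.
set r5 := rho5 umin1 umax1 umin2 umax2.
have r1E : r1 = umax1 - umin1 by [].
have r2E : r2 = r1 + umax1 - umin2 by [].
have r3E : r3 = r2 + umax2 - umin2 by [].
have r4E : r4 = r3 + umax2 - umin1 by [].
have r5E : r5 = umax1 - umin2 + r2 by [].
pose a := sigma0 / g 0.
have a0 : 0 < a by rewrite divr_gt0.
pose Y0 := g 0 * (expR (- a * r4) / (1 - expR (- a * r4))) *
            (2 * expR (a * r1) - 2 * expR (a * r2) + 2 * expR (a * r3)
             - expR (a * r4) - 1).
pose Y1 := ypiece a (g 0) 0 0 Y0 r1.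
pose Y2 := ypiece a (g 0) 1 r1 Y1 r2.
pose Y3 := ypiece a (g 0) 2 r2 Y2 r3.
have Y4 : ypiece a (g 0) 3 r3 Y3 r4 = Y0.
  by apply: ypiece_periodic => //; lra.
(* Lists let the four pieces be treated uniformly; the fifth entries of [v] and [Y] repeat the first
   ones, by periodicity. *)
pose q := nth 0 [:: 0; t1; t2; t3; t4].
pose r := nth 0 [:: 0; r1; r2; r3; r4].
pose v := nth 0 [:: umin1; umax1; umin2; umax2; umin1].
pose Y := nth 0 [:: Y0; Y1; Y2; Y3; Y0].
(* The constant for which arc [i] takes the value [Y i] at input [v i]. *)
pose C i := (Y i - (-1) ^+ i * g 0) * expR (a * (-1) ^+ i * v i).
have e2 i : (-1) ^+ i * (-1) ^+ i = 1 :> R by rewrite -expr2 sqrr_sign.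
have arcE i x : hyst_arc a (g 0) ((-1) ^+ i) (C i) x =
    ypiece a (g 0) i (r i) (Y i) (r i + (-1) ^+ i * (x - v i)).
  by rewrite ypiece_hyst_arc.
have uq i : (i <= 4)%N -> u (q i) = v i.
  by case: i => [|[|[|[|[|]]]]]//= _; rewrite u4.
have rS i : (i < 4)%N -> r i.+1 = r i + (-1) ^+ i * (v i.+1 - v i).
  by case: i => [|[|[|[|]]]]//= _; rewrite /r /v /= ?r4E ?r3E ?r2E ?r1E; ring.
have YS i : (i < 4)%N -> ypiece a (g 0) i (r i) (Y i) (r i.+1) = Y i.+1.
  by case: i => [|[|[|[|]]]].
have qlt i : (i < 4)%N -> q i < q i.+1 by case: i => [|[|[|[|]]]].
have umono i : (i < 4)%N -> forall x y, q i <= x -> x <= y -> y <= q i.+1 ->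
    (-1) ^+ i * u x <= (-1) ^+ i * u y.
  move=> i4 x y qx; rewrite le_eqVlt => /predU1P[->//|xy] yq.
  move: i i4 qx yq; case=> [|[|[|[|]]]]//= _ qx yq.
  - by rewrite !mul1r ltW// inc0.
  - by rewrite !mulN1r lerN2 ltW// dec1.
  - by rewrite sqrrN expr1n !mul1r ltW// inc2.
  - by rewrite exprS sqrrN expr1n mulr1 !mulN1r lerN2 ltW// dec3.
have joint i : (i < 4)%N -> hyst_arc a (g 0) ((-1) ^+ i) (C i) (u (q i.+1)) =
    hyst_arc a (g 0) ((-1) ^+ (i.+1 %% 4)) (C (i.+1 %% 4)%N) (u (q i.+1)).
  move=> i4; rewrite !arcE uq// -rS// YS//.
  have -> : v i.+1 = v (i.+1 %% 4)%N by case: i i4 => [|[|[|[|]]]].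
  have -> : Y i.+1 = Y (i.+1 %% 4)%N by case: i i4 => [|[|[|[|]]]].
  by rewrite subrr mulr0 addr0 ypiece_base.
(* The second swing, from [umax1] down to [umin2], is the smallest of the four. *)
have um i : (i < 4)%N -> umax1 - umin2 <= (-1) ^+ i * (u (q i.+1) - u (q i)).
  move=> i4; rewrite !uq//; last exact: ltnW.
  by case: i i4 => [|[|[|[|]]]]//= _; rewrite /v /= ?exprS ?expr0; lra.
have m0 : 0 < umax1 - umin2 by lra.
have yoE := limit_loop s00 s10 gc gp fc f0 uW uT (erefl : q 0%N = 0) (erefl : q 4%N = t4)
  qlt umono joint m0 um zE yg yk yoc.
pose chi s := (psi_u umin1 umax1 umin2 umax2 s, ycirc sigma0 g umin1 umax1 umin2 umax2 s).
(* At a common endpoint the tests in [psi_u] and [ycirc] select the earlier piece; the case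
   [s = r i] is therefore settled separately, by matching of the endpoint values. *)
have chiE i s : (i < 4)%N -> r i <= s <= r i.+1 ->
    chi s = (v i + (-1) ^+ i * (s - r i), ypiece a (g 0) i (r i) (Y i) s).
  rewrite /chi /psi_u /ycirc -/r1 -/r2 -/r3 -/r4 -/a -/Y0 -/Y1 -/Y2 -/Y3.
  case: i => [|[|[|[|]]]]//= _; rewrite /r /v /Y /= => sr.
  - rewrite ifT; last by lra.
    rewrite ifT; last by lra.
    by congr pair; ring.
  - case: ifPn => s1; last first.
      by rewrite !ifT; [congr pair; lra|lra..].
    have -> : s = r1 by lra.
    by rewrite -/Y1 ypiece_base; congr pair; lra.
  - rewrite ifF; last by apply/negbTE; rewrite -ltNge; lra.
    rewrite [in X in (_, X)]ifF; last by apply/negbTE; rewrite -ltNge; lra.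
    case: ifPn => s1; last first.
      by rewrite !ifT; [congr pair; rewrite ?sqrrN ?expr1n; lra|lra..].
    have -> : s = r2 by lra.
    by rewrite -/Y2 ypiece_base; congr pair; rewrite ?sqrrN ?expr1n; lra.
  - rewrite ifF; last by apply/negbTE; rewrite -ltNge; lra.
    rewrite ifF; last by apply/negbTE; rewrite -ltNge; lra.
    rewrite [in X in (_, X)]ifF; last by apply/negbTE; rewrite -ltNge; lra.
    rewrite [in X in (_, X)]ifF; last by apply/negbTE; rewrite -ltNge; lra.
    case: ifPn => s1; last first.
      by congr pair; rewrite ?exprS ?expr0; lra.
    have -> : s = r3 by lra.
    by rewrite -/Y3 ypiece_base; congr pair; rewrite ?exprS ?expr0; lra.
have qge0 i : (i < 4)%N -> 0 <= q i.
  by case: i => [|[|[|[|]]]]//= _; rewrite /q/=; lra.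
(* The right end [b] is free: a node for a full piece, [t5] for the minor loop. *)
have piece i b : (i < 4)%N -> q i <= b <= q i.+1 ->
    [set (u t, yo t) | t in `[q i, b]] =
    [set chi s | s in `[r i, r i + (-1) ^+ i * (u b - v i)]].
  move=> i4 bq.
  have -> : (-1) ^+ i * (u b - v i) = (-1) ^+ i * u b - (-1) ^+ i * u (q i).
    by rewrite uq ?(ltnW i4)// mulrBr.
  have [_ _ _ uE] := uW.
  have qib : q i <= b by lra.
  apply: (@image_reparam _ _ _ chi (fun t => (-1) ^+ i * u t)) => //.
  - exact: primitive_continuous (primitiveZ _ (primitive_from0 (qge0 _ i4) uE qib)) qib.
  - by move=> x y qx xy yb; apply: umono => //; lra.
  - move=> t tq.
    have tq' : q i <= t <= q i.+1 by lra.
    rewrite -mulrBr uq ?(ltnW i4)// (chiE i)//; last first.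
      rewrite rS// lerDl lerD2l -!uq ?(ltnW i4)// !mulrBr subr_ge0 lerD2r.
      by rewrite !umono//; lra.
    by rewrite (yoE i)// arcE; congr pair; rewrite [r i + _]addrC addrK mulrA e2 mul1r subrKC.
have full i : (i < 4)%N -> [set (u t, yo t) | t in `[q i, q i.+1]] =
    [set chi s | s in `[r i, r i.+1]].
  move=> i4; rewrite piece// ?uq// -?rS//.
  by rewrite lexx ltW// qlt.
have := full 0%N isT; have := full 1%N isT; have := full 2%N isT; have := full 3%N isT.
rewrite /q /r /= => F3 F2 F1 F0.
split.
  rewrite (@itv_cc_setU _ 0 t1 t4) ?(@itv_cc_setU _ t1 t2 t4) ?(@itv_cc_setU _ t2 t3 t4); [|lra..].
  rewrite (@itv_cc_setU _ 0 r1 r4) ?(@itv_cc_setU _ r1 r2 r4) ?(@itv_cc_setU _ r2 r3 r4); [|lra..].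
  by rewrite !image_setU F0 F1 F2 F3.
rewrite (@itv_cc_setU _ t1 t2 t5) ?(@itv_cc_setU _ r1 r2 r5); [|lra..].
rewrite !image_setU F1; congr setU.
(* At [t5] the third piece has climbed from [umin2] back to [umax1], a variation of [umax1 - umin2],
   which is [r5 - r2]. *)
have := piece 2%N t5 isT; rewrite /q /r /v/= => ->; last by lra.
have -> : r5 = r2 + (umax1 - umin2) by lra.
by rewrite u5 u1 sqrrN expr1n mul1r.
Qed.
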